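(* Let $\varphi,\theta,\kappa_{1,1},\kappa_{1,2},\kappa_{2,1},\kappa_{2,2},\kappa_{3,1},\kappa_{3,2},\kappa_{5,1},a_1,a_2,b_1,b_2,c_1,c_2,e_1$ be the real constants of Romik's explicit representation of Gerver's sofa, i.e. real numbers with the values listed in the context. Let $(X(\alpha),Y(\alpha))$ be the corresponding trajectory of the interior corner $A$ given piecewise in the context, and define $$r(\alpha)=\frac{X(\alpha)}{\cos\alpha},\qquad t(\alpha)=\frac{Y(\alpha)}{\sin\alpha}.$$ Then $(r,t)$ satisfies the Euler--Lagrange equations $\mathrm{ODE1}=0$ and $\mathrm{ODE2}=0$ of the sofa area functional on each of the intervals $0<\alpha<2\varphi$, $2\varphi<\alpha<2\theta$ and $2\theta<\alpha<\pi/2$, where (with $r,t$ and their derivatives evaluated at $\alpha$): (i) for $0<\alpha<2\varphi$, $$\begin{aligned}\mathrm{ODE1}=-\tfrac12\cos\alpha\Big(&-\cos\tfrac{\alpha}{2}+\sin\tfrac{\alpha}{2}-2(-3\cos\alpha+\cos2\alpha)\,r+2(-3\cos\alpha+\cos2\alpha)\,t+12\sin\alpha\, r'-3\sin2\alpha\, r'\\&-6\sin\alpha\, t'+3\sin2\alpha\, t'+r''-6\cos\alpha\, r''+\cos2\alpha\, r''+t''-\cos2\alpha\, t''\Big),\end{aligned}$$ $$\begin{aligned}\mathrm{ODE2}=\tfrac12\sin\alpha\Big(&\cos\tfrac{\alpha}{2}+\sin\tfrac{\alpha}{2}+2(3\sin\alpha+\sin2\alpha)\,r-2(3\sin\alpha+\sin2\alpha)\,t+r'-6\cos\alpha\,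 r'-3\cos2\alpha\, r'\\&+t'+12\cos\alpha\, t'+3\cos2\alpha\, t'-\sin2\alpha\, r''+6\sin\alpha\, t''+\sin2\alpha\, t''\Big);\end{aligned}$$ (ii) for $2\varphi<\alpha<2\theta$, $$\begin{aligned}\mathrm{ODE1}=-\tfrac12\cos\alpha\Big(&-\cos\tfrac{\alpha}{2}+\sin\tfrac{\alpha}{2}-2(-3\cos\alpha+\cos2\alpha)\,r+2(-2\cos\alpha+\cos2\alpha)\,t+12\sin\alpha\, r'-3\sin2\alpha\, r'\\&-4\sin\alpha\, t'+3\sin2\alpha\, t'+r''-6\cos\alpha\, r''+\cos2\alpha\, r''+t''-\cos2\alpha\, t''\Big),\end{aligned}$$ $$\begin{aligned}\mathrm{ODE2}=\tfrac12\sin\alpha\Big(&\cos\tfrac{\alpha}{2}+\sin\tfrac{\alpha}{2}+4(1+\cos\alpha)\sin\alpha\, r-2(3\sin\alpha+\sin2\alpha)\,t+r'-4\cos\alpha\, r'-3\cos2\alpha\, r'\\&+t'+12\cos\alpha\, t'+3\cos2\alpha\, t'-\sin2\alpha\, r''+6\sin\alpha\, t''+\sin2\alpha\, t''\Big);\end{aligned}$$ (iii) for $2\theta<\alpha<\pi/2$, $$\mathrm{ODE1}=-\tfrac12\cos\alpha\Big(-\cos\tfrac{\alpha}{2}+\sin\tfrac{\alpha}{2}+4\cos\alpha\, r-2\cos\alpha\, t+8\sin\alpha\, r'-2\sin\alpha\, t'-4\cos\alpha\, r''\Big),$$ $$\mathrm{ODE2}=\tfrac12\sin\alpha\Big(\cos\tfrac{\alpha}{2}+\sin\tfrac{\alpha}{2}+2\sin\alpha\,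 r-4\sin\alpha\, t-2\cos\alpha\, r'+8\cos\alpha\, t'+4\sin\alpha\, t''\Big).$$
   Context: Background. An L-shaped hallway of unit width is rotated relative to the sofa, with rotation parameter $\alpha\in[0,\pi]$. The interior corner $A$ of the hallway has coordinates $(r(\alpha)\cos\alpha,\ t(\alpha)\sin\alpha)$. Assuming symmetry about $\alpha=\pi/2$ (that is, $r(\alpha)=r(\pi-\alpha)$, $t(\alpha)=t(\pi-\alpha)$), the area of the sofa is $2\int_0^{\pi/2}F\,d\alpha$ for a piecewise integrand $F$ depending on $r,t,r',t',r'',t''$. The necessary conditions for maximal area are the Euler--Lagrange equations $\frac{\partial F}{\partial r}-\frac{d}{d\alpha}\frac{\partial F}{\partial r'}+\frac{d^2}{d\alpha^2}\frac{\partial F}{\partial r''}=0$ (ODE1 $=0$) and the same with $t$ in place of $r$ (ODE2 $=0$). For the statement, ODE1 and ODE2 are the explicit expressions given in the claim. Trajectory of $A$ for Gerver's sofa (Romik's explicit formulas, with Romik's parameter equal to $\alpha/2$, translated horizontally so that the shape is symmetric about the $y$-axis). Write $s=\alpha/2$ and define the vector-valued functions $$\mathbf x_1(s)=\Big(\kappa_{1,1}-\sin s\,(a_1\sin s-a_2\cos s-\tfrac12)+\cos s\,(a_2\sin s+a_1\cos s-1),\ \ \kappa_{1,2}+\cos s\,(a_1\sin s-a_2\cos s-\tfrac12)+\sin s\,(a_2\sin s+a_1\cos s-1)\Big),$$ $$\mathbf x_2(s)=\Big(\kappa_{2,1}+(b_1s+b_2-\tfrac{s^2}{4})\cos s-(-b_1+\tfrac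 s2-1)\sin s,\ \ \kappa_{2,2}+(b_1s+b_2-\tfrac{s^2}{4})\sin s+(-b_1+\tfrac s2-1)\cos s\Big),$$ $$\mathbf x_3(s)=\Big(\kappa_{3,1}-(c_2+s)\sin s+(c_1-s)\cos s,\ \ \kappa_{3,2}+(c_1-s)\sin s+(c_2+s)\cos s\Big).$$ Then $$(X(\alpha),Y(\alpha))=\mathbf x_j(\alpha/2)-\Big(\tfrac12(1-e_1+\kappa_{5,1}),\,0\Big),$$ with $j=1$ for $0<\alpha<2\varphi$, $j=2$ for $2\varphi<\alpha<2\theta$, and $j=3$ for $2\theta<\alpha<\pi/2$. Constants. $\kappa_{1,2}=\tfrac14$, $a_2=-\tfrac14$, and the others are real numbers having the following values (to within $10^{-20}$): $\varphi=0.039177364790083641863217875242$, $\theta=0.681301509382724894473855757083$, $\kappa_{1,1}=-0.210322422072688751416185718488$, $\kappa_{2,1}=-0.919179292771593322274696102894$, $\kappa_{2,2}=0.472406619750805465181760762512$, $\kappa_{3,1}=-0.613763229430251668554914291318$, $\kappa_{3,2}=0.889626479003221860727043050048$, $\kappa_{5,1}=-1.017204036787814585693642864415$, $a_1=e_1=1.210322422072688751416185718490$, $b_1=-0.527624598026784624160503809373$, $b_2=0.920258385160637622893705795012$, $c_1=0.626045522848465867552329310386$, $c_2=-0.944750803946430751678992381254$. *)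

(* Defs.v *)
From Stdlib Require Import Reals.
From Coquelicot Require Import Coquelicot.
Open Scope R_scope.

Record constants : Type := Constants {
  phi : R; theta : R;
  kappa11 : R; kappa12 : R;
  kappa21 : R; kappa22 : R;
  kappa31 : R; kappa32 : R;
  kappa51 : R;
  a1 : R; a2 : R;
  b1 : R; b2 : R;
  c1 : R; c2 : R;
  e1 : R
}.

Definition has_value (x v : R) : Prop := Rabs (x - v) <= / 10 ^ 20.

(* The constants of Romik's representation of Gerver's sofa are known here only
   through their numerical values: [kappa12], [a2] and the equality [a1 = e1]
   are exact, everything else is prescribed up to 10^-20. *)
Definition gerver_constants (K : constants) : Prop :=
  kappa12 K = 1 / 4 /\
  a2 K = - (1 / 4) /\
  a1 K = e1 K /\
  has_value (phi K) 0.039177364790083641863217875242 /\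
  has_value (theta K) 0.681301509382724894473855757083 /\
  has_value (kappa11 K) (-0.210322422072688751416185718488) /\
  has_value (kappa21 K) (-0.919179292771593322274696102894) /\
  has_value (kappa22 K) 0.472406619750805465181760762512 /\
  has_value (kappa31 K) (-0.613763229430251668554914291318) /\
  has_value (kappa32 K) 0.889626479003221860727043050048 /\
  has_value (kappa51 K) (-1.017204036787814585693642864415) /\
  has_value (e1 K) 1.210322422072688751416185718490 /\
  has_value (b1 K) (-0.527624598026784624160503809373) /\
  has_value (b2 K) 0.920258385160637622893705795012 /\
  has_value (c1 K) 0.626045522848465867552329310386 /\
  has_value (c2 K) (-0.944750803946430751678992381254).

Definition x1 (K : constants) (s : R) : R * R :=
  (kappa11 K - sin s * (a1 K * sin s - a2 K * cos s - 1 / 2)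
     + cos s * (a2 K * sin s + a1 K * cos s - 1),
   kappa12 K + cos s * (a1 K * sin s - a2 K * cos s - 1 / 2)
     + sin s * (a2 K * sin s + a1 K * cos s - 1)).

Definition x2 (K : constants) (s : R) : R * R :=
  (kappa21 K + (b1 K * s + b2 K - s ^ 2 / 4) * cos s
     - (- b1 K + s / 2 - 1) * sin s,
   kappa22 K + (b1 K * s + b2 K - s ^ 2 / 4) * sin s
     + (- b1 K + s / 2 - 1) * cos s).

Definition x3 (K : constants) (s : R) : R * R :=
  (kappa31 K - (c2 K + s) * sin s + (c1 K - s) * cos s,
   kappa32 K + (c1 K - s) * sin s + (c2 K + s) * cos s).

(* Only the values on the open intervals (0, 2 phi), (2 phi, 2 theta) and
   (2 theta, PI/2) are meaningful; those elsewhere, breakpoints included, are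
   an arbitrary extension. *)
Definition xpiece (K : constants) (alpha : R) : R * R :=
  if Rlt_dec alpha (2 * phi K) then x1 K (alpha / 2)
  else if Rlt_dec alpha (2 * theta K) then x2 K (alpha / 2)
  else x3 K (alpha / 2).

Definition X (K : constants) (alpha : R) : R :=
  fst (xpiece K alpha) - 1 / 2 * (1 - e1 K + kappa51 K).

Definition Y (K : constants) (alpha : R) : R := snd (xpiece K alpha).

Definition r_gerver (K : constants) (alpha : R) : R := X K alpha / cos alpha.

Definition t_gerver (K : constants) (alpha : R) : R := Y K alpha / sin alpha.

(* In the expressions below [r r' r'' t t' t''] are the values at [alpha] of
   the two unknown functions and of their first two derivatives. *)
Definition ODE1_i (alpha r r' r'' t t' t'' : R) : R :=
  - (1 / 2) * cos alpha *
  (- cos (alpha / 2) + sin (alpha / 2)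
   - 2 * (- 3 * cos alpha + cos (2 * alpha)) * r
   + 2 * (- 3 * cos alpha + cos (2 * alpha)) * t
   + 12 * sin alpha * r' - 3 * sin (2 * alpha) * r'
   - 6 * sin alpha * t' + 3 * sin (2 * alpha) * t'
   + r'' - 6 * cos alpha * r'' + cos (2 * alpha) * r''
   + t'' - cos (2 * alpha) * t'').

Definition ODE2_i (alpha r r' r'' t t' t'' : R) : R :=
  1 / 2 * sin alpha *
  (cos (alpha / 2) + sin (alpha / 2)
   + 2 * (3 * sin alpha + sin (2 * alpha)) * r
   - 2 * (3 * sin alpha + sin (2 * alpha)) * t
   + r' - 6 * cos alpha * r' - 3 * cos (2 * alpha) * r'
   + t' + 12 * cos alpha * t' + 3 * cos (2 * alpha) * t'
   - sin (2 * alpha) * r'' + 6 * sin alpha * t'' + sin (2 * alpha) * t'').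

Definition ODE1_ii (alpha r r' r'' t t' t'' : R) : R :=
  - (1 / 2) * cos alpha *
  (- cos (alpha / 2) + sin (alpha / 2)
   - 2 * (- 3 * cos alpha + cos (2 * alpha)) * r
   + 2 * (- 2 * cos alpha + cos (2 * alpha)) * t
   + 12 * sin alpha * r' - 3 * sin (2 * alpha) * r'
   - 4 * sin alpha * t' + 3 * sin (2 * alpha) * t'
   + r'' - 6 * cos alpha * r'' + cos (2 * alpha) * r''
   + t'' - cos (2 * alpha) * t'').

Definition ODE2_ii (alpha r r' r'' t t' t'' : R) : R :=
  1 / 2 * sin alpha *
  (cos (alpha / 2) + sin (alpha / 2)
   + 4 * (1 + cos alpha) * sin alpha * r
   - 2 * (3 * sin alpha + sin (2 * alpha)) * t
   + r' - 4 * cos alpha * r' - 3 * cos (2 * alpha) * r'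
   + t' + 12 * cos alpha * t' + 3 * cos (2 * alpha) * t'
   - sin (2 * alpha) * r'' + 6 * sin alpha * t'' + sin (2 * alpha) * t'').

Definition ODE1_iii (alpha r r' r'' t t' t'' : R) : R :=
  - (1 / 2) * cos alpha *
  (- cos (alpha / 2) + sin (alpha / 2)
   + 4 * cos alpha * r - 2 * cos alpha * t
   + 8 * sin alpha * r' - 2 * sin alpha * t'
   - 4 * cos alpha * r'').

Definition ODE2_iii (alpha r r' r'' t t' t'' : R) : R :=
  1 / 2 * sin alpha *
  (cos (alpha / 2) + sin (alpha / 2)
   + 2 * sin alpha * r - 4 * sin alpha * t
   - 2 * cos alpha * r' + 8 * cos alpha * t'
   + 4 * sin alpha * t'').

(* [Derive] is total (a junk value where the derivative does not exist), so
   being twice differentiable is part of being a solution. *)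
Definition twice_differentiable_on (f : R -> R) (a b : R) : Prop :=
  forall alpha : R, a < alpha < b -> ex_derive f alpha /\ ex_derive (Derive f) alpha.

Definition vanishes_along (ODE : R -> R -> R -> R -> R -> R -> R -> R)
    (r t : R -> R) (a b : R) : Prop :=
  forall alpha : R, a < alpha < b ->
    ODE alpha (r alpha) (Derive r alpha) (Derive (Derive r) alpha)
              (t alpha) (Derive t alpha) (Derive (Derive t) alpha) = 0.

Definition solves (ODE1 ODE2 : R -> R -> R -> R -> R -> R -> R -> R)
    (r t : R -> R) (a b : R) : Prop :=
  twice_differentiable_on r a b /\ twice_differentiable_on t a b /\
  vanishes_along ODE1 r t a b /\ vanishes_along ODE2 r t a b.

(* Main.v *)
Require Import Defs.
From Stdlib Require Import Reals Lra.
From Coquelicot Require Import Coquelicot.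
Open Scope R_scope.

(** In terms of the trajectory [x = r cos alpha], [y = t sin alpha] the
    Euler-Lagrange equations have constant coefficients up to a rotation by
    [alpha] and involve only the derivatives of [x] and [y]. Each piece of the
    trajectory has the form [x = k + u cos s - v sin s],
    [y = l + u sin s + v cos s] with [s = alpha / 2], and the equations become
    identities once [u] and [v] are inserted, whatever the values of the
    constants: the numerical values matter only through
    [0 < phi < theta < PI / 4]. *)

(** * Differentiating [r] and [t] through the trajectory *)

(** Derivatives are local and the interval is open, so agreement on it suffices; the piecewise
    trajectory follows a single formula only between its breakpoints. The second derivative requires
    [Derive f = g1] on a neighbourhood, not merely at the point. *)
Lemma twice_derive_on_ext (f g g1 g2 : R -> R) (a b : R) :
  (forall z, a < z < b -> f z = g z) ->
  (forall z, a < z < b -> is_derive g z (g1 z)) ->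
  (forall z, a < z < b -> is_derive g1 z (g2 z)) ->
  twice_differentiable_on f a b /\
  forall z, a < z < b -> Derive f z = g1 z /\ Derive (Derive f) z = g2 z.
Proof.
  intros Hfg Hg Hg1.
  assert (Hloc : forall P : R -> Prop, (forall z, a < z < b -> P z) ->
                 forall z, a < z < b -> locally z P).
  { intros P HP z Hz.
    apply (filter_imp (fun y => a < y < b) P HP).
    apply (open_and (fun y => a < y) (fun y => y < b));
      [apply open_gt | apply open_lt | exact Hz]. }
  assert (Hf : forall z, a < z < b -> is_derive f z (g1 z)).
  { intros z Hz. apply (is_derive_ext_loc g f).
    - apply Hloc; [intros y Hy; symmetry; auto | exact Hz].
    - auto. }
  assert (Hf1 : forall z, a < z < b -> is_derive (Derive f) z (g2 z)).
  { intros z Hz. apply (is_derive_ext_loc g1 (Derive f)).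
    - apply Hloc; [| exact Hz].
      intros y Hy; symmetry; apply is_derive_unique; auto.
    - auto. }
  split.
  - intros z Hz; split; eexists; [apply Hf | apply Hf1]; exact Hz.
  - intros z Hz; split; apply is_derive_unique; auto.
Qed.

(** The last premise treats the derivatives of [r] and [t] as free numbers tied to the trajectory by
    the product rule for [x = r cos z] and [y = t sin z]; this turns the differential equations into
    algebra. Inside (0, pi/2) both [cos z] and [sin z] are nonzero, so the quotients are
    differentiable. *)
Lemma solves_of_trajectory (ODE1 ODE2 : R -> R -> R -> R -> R -> R -> R -> R)
    (x dx ddx y dy ddy r t : R -> R) (a b : R) :
  0 <= a -> b <= PI / 2 ->
  (forall z, is_derive x z (dx z)) -> (forall z, is_derive dx z (ddx z)) ->
  (forall z, is_derive y z (dy z)) -> (forall z, is_derive dy z (ddy z)) ->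
  (forall z, a < z < b -> r z = x z / cos z) ->
  (forall z, a < z < b -> t z = y z / sin z) ->
  (forall z r0 r1 r2 t0 t1 t2,
     dx z = cos z * r1 - sin z * r0 ->
     ddx z = cos z * r2 - 2 * sin z * r1 - cos z * r0 ->
     dy z = sin z * t1 + cos z * t0 ->
     ddy z = sin z * t2 + 2 * cos z * t1 - sin z * t0 ->
     ODE1 z r0 r1 r2 t0 t1 t2 = 0 /\ ODE2 z r0 r1 r2 t0 t1 t2 = 0) ->
  solves ODE1 ODE2 r t a b.
Proof.
  intros Ha Hb Hx Hdx Hy Hdy Hr Ht HODE.
  assert (Hc : forall z, a < z < b -> cos z <> 0).
  { intros z Hz. apply Rgt_not_eq, cos_gt_0; lra. }
  assert (Hs : forall z, a < z < b -> sin z <> 0).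
  { intros z Hz. apply Rgt_not_eq, sin_gt_0; lra. }
  (* Each candidate derivative is found by solving the product rule for its term of highest
     order. *)
  pose (r1 z := (dx z + sin z * (x z / cos z)) / cos z).
  pose (r2 z := (ddx z + 2 * sin z * r1 z + cos z * (x z / cos z)) / cos z).
  pose (t1 z := (dy z - cos z * (y z / sin z)) / sin z).
  pose (t2 z := (ddy z - 2 * cos z * t1 z + sin z * (y z / sin z)) / sin z).
  assert (Ex : forall z, ex_derive x z) by (intros z; eexists; apply Hx).
  assert (Edx : forall z, ex_derive dx z) by (intros z; eexists; apply Hdx).
  assert (Ey : forall z, ex_derive y z) by (intros z; eexists; apply Hy).
  assert (Edy : forall z, ex_derive dy z) by (intros z; eexists; apply Hdy).
  assert (Dx : forall z, Derive x z = dx z) by (intros z; apply is_derive_unique, Hx).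
  assert (Ddx : forall z, Derive dx z = ddx z) by (intros z; apply is_derive_unique, Hdx).
  assert (Dy : forall z, Derive y z = dy z) by (intros z; apply is_derive_unique, Hy).
  assert (Ddy : forall z, Derive dy z = ddy z) by (intros z; apply is_derive_unique, Hdy).
  destruct (twice_derive_on_ext r (fun z => x z / cos z) r1 r2 a b Hr)
    as [Hr2 Dr].
  { intros z Hz; specialize (Hc z Hz). auto_derive; [auto |].
    change (Derive (fun y => x y) z) with (Derive x z).
    rewrite Dx. unfold r1. field; auto. }
  { intros z Hz; specialize (Hc z Hz). unfold r1. auto_derive; [auto 10 |].
    change (Derive (fun y => x y) z) with (Derive x z).
    change (Derive (fun y => dx y) z) with (Derive dx z).
    rewrite Dx, Ddx. unfold r2, r1. field; auto. }
  destruct (twice_derive_on_ext t (fun z => y z / sin z) t1 t2 a b Ht)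
    as [Ht2 Dt].
  { intros z Hz; specialize (Hs z Hz). auto_derive; [auto |].
    change (Derive (fun x => y x) z) with (Derive y z).
    rewrite Dy. unfold t1. field; auto. }
  { intros z Hz; specialize (Hs z Hz). unfold t1. auto_derive; [auto 10 |].
    change (Derive (fun x => y x) z) with (Derive y z).
    change (Derive (fun x => dy x) z) with (Derive dy z).
    rewrite Dy, Ddy. unfold t2, t1. field; auto. }
  assert (HO : forall z, a < z < b ->
    ODE1 z (r z) (Derive r z) (Derive (Derive r) z)
           (t z) (Derive t z) (Derive (Derive t) z) = 0 /\
    ODE2 z (r z) (Derive r z) (Derive (Derive r) z)
           (t z) (Derive t z) (Derive (Derive t) z) = 0).
  { intros z Hz; specialize (Hc z Hz); specialize (Hs z Hz).
    destruct (Dr z Hz) as [-> ->]. destruct (Dt z Hz) as [-> ->].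
    rewrite (Hr z Hz), (Ht z Hz).
    apply HODE; unfold r2, t2, r1, t1; field; auto. }
  split; [exact Hr2 |]. split; [exact Ht2 |].
  split; intros z Hz; apply HO, Hz.
Qed.

(** With [w = u + i v] the trajectory is a constant plus [exp(i s) w]. Differentiating in [s]
    replaces [w] by [w' + i w], then by [w'' + 2 i w' - w]; the factors 1/2 and 1/4 come from
    [s = z / 2]. *)
Lemma solves_of_moving_frame (ODE1 ODE2 : R -> R -> R -> R -> R -> R -> R -> R)
    (u u1 u2 v v1 v2 : R -> R) (k l : R) (r t : R -> R) (a b : R) :
  0 <= a -> b <= PI / 2 ->
  (forall s, is_derive u s (u1 s)) -> (forall s, is_derive u1 s (u2 s)) ->
  (forall s, is_derive v s (v1 s)) -> (forall s, is_derive v1 s (v2 s)) ->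
  (forall z, a < z < b ->
     r z = (k + u (z / 2) * cos (z / 2) - v (z / 2) * sin (z / 2)) / cos z) ->
  (forall z, a < z < b ->
     t z = (l + u (z / 2) * sin (z / 2) + v (z / 2) * cos (z / 2)) / sin z) ->
  (forall z s r0 r1 r2 t0 t1 t2,
     s = z / 2 ->
     cos z * r1 - sin z * r0 =
       1 / 2 * ((u1 s - v s) * cos s - (v1 s + u s) * sin s) ->
     cos z * r2 - 2 * sin z * r1 - cos z * r0 =
       1 / 4 * ((u2 s - 2 * v1 s - u s) * cos s
                - (v2 s + 2 * u1 s - v s) * sin s) ->
     sin z * t1 + cos z * t0 =
       1 / 2 * ((u1 s - v s) * sin s + (v1 s + u s) * cos s) ->
     sin z * t2 + 2 * cos z * t1 - sin z * t0 =
       1 / 4 * ((u2 s - 2 * v1 s - u s) * sin s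
                + (v2 s + 2 * u1 s - v s) * cos s) ->
     ODE1 z r0 r1 r2 t0 t1 t2 = 0 /\ ODE2 z r0 r1 r2 t0 t1 t2 = 0) ->
  solves ODE1 ODE2 r t a b.
Proof.
  intros Ha Hb Hu Hu1 Hv Hv1 Hr Ht HODE.
  assert (Eu : forall s, ex_derive u s) by (intros s; eexists; apply Hu).
  assert (Eu1 : forall s, ex_derive u1 s) by (intros s; eexists; apply Hu1).
  assert (Ev : forall s, ex_derive v s) by (intros s; eexists; apply Hv).
  assert (Ev1 : forall s, ex_derive v1 s) by (intros s; eexists; apply Hv1).
  assert (Du : forall s, Derive (fun y => u y) s = u1 s)
    by (intros s; apply is_derive_unique, Hu).
  assert (Du1 : forall s, Derive (fun y => u1 y) s = u2 s)
    by (intros s; apply is_derive_unique, Hu1).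
  assert (Dv : forall s, Derive (fun y => v y) s = v1 s)
    by (intros s; apply is_derive_unique, Hv).
  assert (Dv1 : forall s, Derive (fun y => v1 y) s = v2 s)
    by (intros s; apply is_derive_unique, Hv1).
  apply (solves_of_trajectory ODE1 ODE2
    (fun z => k + u (z / 2) * cos (z / 2) - v (z / 2) * sin (z / 2))
    (fun z => let s := z / 2 in
       1 / 2 * ((u1 s - v s) * cos s - (v1 s + u s) * sin s))
    (fun z => let s := z / 2 in
       1 / 4 * ((u2 s - 2 * v1 s - u s) * cos s
                - (v2 s + 2 * u1 s - v s) * sin s))
    (fun z => l + u (z / 2) * sin (z / 2) + v (z / 2) * cos (z / 2))
    (fun z => let s := z / 2 in
       1 / 2 * ((u1 s - v s) * sin s + (v1 s + u s) * cos s))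
    (fun z => let s := z / 2 in
       1 / 4 * ((u2 s - 2 * v1 s - u s) * sin s
                + (v2 s + 2 * u1 s - v s) * cos s)));
    try assumption.
  1-4: intros z; cbv beta zeta; auto_derive; [repeat split; auto |];
    rewrite ?Du, ?Du1, ?Dv, ?Dv1; change (z * / 2) with (z / 2); field.
  intros z r0 r1 r2 t0 t1 t2 E1 E2 E3 E4.
  apply (HODE z (z / 2)); auto.
Qed.

(** * The equations in terms of the derivatives of the trajectory *)

Lemma sin_sqr (z : R) : sin z * sin z = 1 - cos z * cos z.
Proof. exact (sin2 z). Qed.

(** Once the product rule and the double-angle formulas are inserted, both sides are polynomials in
    [cos z] and [sin z] that agree modulo [sin_sqr]. *)
Lemma ODE_i_trajectory (z r r1 r2 t t1 t2 dx ddx dy ddy : R) :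
  cos z * r1 - sin z * r = dx ->
  cos z * r2 - 2 * sin z * r1 - cos z * r = ddx ->
  sin z * t1 + cos z * t = dy ->
  sin z * t2 + 2 * cos z * t1 - sin z * t = ddy ->
  ODE1_i z r r1 r2 t t1 t2 =
    - (1 / 2) * cos z * (- cos (z / 2) + sin (z / 2) - 6 * ddx - 6 * dy
      + 2 * (cos z * ddx - sin z * dx) + 2 * (sin z * ddy + cos z * dy)) /\
  ODE2_i z r r1 r2 t t1 t2 =
    1 / 2 * sin z * (cos (z / 2) + sin (z / 2) - 6 * dx + 6 * ddy
      - 2 * (sin z * ddx + cos z * dx) + 2 * (cos z * ddy - sin z * dy)).
Proof.
  intros <- <- <- <-; unfold ODE1_i, ODE2_i.
  rewrite sin_2a, cos_2a. pose proof (sin_sqr z) as H.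
  split; ring [H].
Qed.

Lemma ODE_ii_trajectory (z r r1 r2 t t1 t2 dx ddx dy ddy : R) :
  cos z * r1 - sin z * r = dx ->
  cos z * r2 - 2 * sin z * r1 - cos z * r = ddx ->
  sin z * t1 + cos z * t = dy ->
  sin z * t2 + 2 * cos z * t1 - sin z * t = ddy ->
  ODE1_ii z r r1 r2 t t1 t2 =
    - (1 / 2) * cos z * (- cos (z / 2) + sin (z / 2) - 6 * ddx - 4 * dy
      + 2 * (cos z * ddx - sin z * dx) + 2 * (sin z * ddy + cos z * dy)) /\
  ODE2_ii z r r1 r2 t t1 t2 =
    1 / 2 * sin z * (cos (z / 2) + sin (z / 2) - 4 * dx + 6 * ddy
      - 2 * (sin z * ddx + cos z * dx) + 2 * (cos z * ddy - sin z * dy)).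
Proof.
  intros <- <- <- <-; unfold ODE1_ii, ODE2_ii.
  rewrite sin_2a, cos_2a. pose proof (sin_sqr z) as H.
  split; ring [H].
Qed.

(** No terms rotated by [z] occur in this phase, so the identity is linear in [cos z] and [sin z]
    inside the brackets. *)
Lemma ODE_iii_trajectory (z r r1 r2 t t1 t2 dx ddx dy ddy : R) :
  cos z * r1 - sin z * r = dx ->
  cos z * r2 - 2 * sin z * r1 - cos z * r = ddx ->
  sin z * t1 + cos z * t = dy ->
  sin z * t2 + 2 * cos z * t1 - sin z * t = ddy ->
  ODE1_iii z r r1 r2 t t1 t2 =
    - (1 / 2) * cos z * (- cos (z / 2) + sin (z / 2) - 4 * ddx - 2 * dy) /\
  ODE2_iii z r r1 r2 t t1 t2 =
    1 / 2 * sin z * (cos (z / 2) + sin (z / 2) - 2 * dx + 4 * ddy).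
Proof.
  intros <- <- <- <-; unfold ODE1_iii, ODE2_iii.
  split; ring.
Qed.

(** This coarse tolerance, together with [3 / 2 < PI / 2], already gives
    [0 < phi < theta < PI / 4]. *)
Lemma has_value_bounds (x v : R) :
  has_value x v -> v - 1 / 100 <= x <= v + 1 / 100.
Proof.
  unfold has_value; intros H.
  assert (/ 10 ^ 20 <= 1 / 100) by lra.
  apply Rabs_le_between in H; lra.
Qed.

(** Passing from [z] to [s] leaves [cos s] and [sin s] as the only trigonometric terms. *)
Lemma cos_half_angle (z s : R) : s = z / 2 -> cos z = 2 * (cos s * cos s) - 1.
Proof.
  intros ->. rewrite <- Rmult_assoc, <- cos_2a_cos. f_equal; field.
Qed.

Lemma sin_half_angle (z s : R) : s = z / 2 -> sin z = 2 * sin s * cos s.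
Proof.
  intros ->. rewrite <- sin_2a. f_equal; field.
Qed.

Theorem theorem5 (K : constants) (hK : gerver_constants K) :
  solves ODE1_i ODE2_i (r_gerver K) (t_gerver K) 0 (2 * phi K) /\
  solves ODE1_ii ODE2_ii (r_gerver K) (t_gerver K) (2 * phi K) (2 * theta K) /\
  solves ODE1_iii ODE2_iii (r_gerver K) (t_gerver K) (2 * theta K) (PI / 2).
Proof.
  destruct hK as (_ & _ & _ & Hphi & Htheta & _).
  apply has_value_bounds in Hphi, Htheta.
  pose proof PI2_3_2 as HPI.
  (* The horizontal shift is absorbed into the additive constant [k], which differentiation
     removes. *)
  pose (d := 1 / 2 * (1 - e1 K + kappa51 K)).
  split; [| split].
  (* The [a1], [a2] part of the trajectory is a complex multiple of [exp(i z)]; it satisfies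
     [ddx = - dy], [ddy = dx] and so solves the homogeneous equations. The constants [- 1] and
     [- 1 / 2] balance the forcing terms. *)
  - apply (solves_of_moving_frame ODE1_i ODE2_i
      (fun s => a2 K * sin s + a1 K * cos s - 1)
      (fun s => a2 K * cos s - a1 K * sin s)
      (fun s => - (a2 K * sin s + a1 K * cos s))
      (fun s => a1 K * sin s - a2 K * cos s - 1 / 2)
      (fun s => a1 K * cos s + a2 K * sin s)
      (fun s => a2 K * cos s - a1 K * sin s)
      (kappa11 K - d) (kappa12 K)); try lra.
    1-4: intros s; auto_derive; [auto | ring].
    + intros z Hz. unfold r_gerver, X, xpiece, d.
      destruct (Rlt_dec z (2 * phi K)); [| lra].
      simpl. f_equal; ring.
    + intros z Hz. unfold t_gerver, Y, xpiece.
      destruct (Rlt_dec z (2 * phi K)); [| lra].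
      simpl. f_equal; ring.
    + intros z s r0 r1 r2 t0 t1 t2 Es H1 H2 H3 H4.
      destruct (ODE_i_trajectory _ _ _ _ _ _ _ _ _ _ _ H1 H2 H3 H4) as [-> ->].
      rewrite <- Es, (cos_half_angle z s Es), (sin_half_angle z s Es).
      pose proof (sin_sqr s) as H.
      (* Only the bracket has to vanish, and it does so modulo [H]. *)
      split; apply Rmult_eq_0_compat_l; field [H].
  (* Here [v = - u1 - 1], with [u2] and [v1] constant: the terms in [u] and [u1] cancel, and the
     remaining constants balance the forcing. *)
  - apply (solves_of_moving_frame ODE1_ii ODE2_ii
      (fun s => b1 K * s + b2 K - s ^ 2 / 4) (fun s => b1 K - s / 2)
      (fun s => - (1 / 2))
      (fun s => - b1 K + s / 2 - 1) (fun s => 1 / 2) (fun s => 0)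
      (kappa21 K - d) (kappa22 K)); try lra.
    1-4: intros s; auto_derive; [auto | field].
    + intros z Hz. unfold r_gerver, X, xpiece, d.
      destruct (Rlt_dec z (2 * phi K)); [lra |].
      destruct (Rlt_dec z (2 * theta K)); [| lra].
      unfold x2, fst. f_equal; ring.
    + intros z Hz. unfold t_gerver, Y, xpiece.
      destruct (Rlt_dec z (2 * phi K)); [lra |].
      destruct (Rlt_dec z (2 * theta K)); [| lra].
      unfold x2, snd. f_equal; ring.
    + intros z s r0 r1 r2 t0 t1 t2 Es H1 H2 H3 H4.
      destruct (ODE_ii_trajectory _ _ _ _ _ _ _ _ _ _ _ H1 H2 H3 H4) as [-> ->].
      rewrite <- Es, (cos_half_angle z s Es), (sin_half_angle z s Es).
      pose proof (sin_sqr s) as H.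
      split; apply Rmult_eq_0_compat_l; field [H].
  (* With slopes [- 1] and [1], the terms in [u] and [v] cancel in [- 4 ddx - 2 dy] and
     [- 2 dx + 4 ddy]. *)
  - apply (solves_of_moving_frame ODE1_iii ODE2_iii
      (fun s => Defs.c1 K - s) (fun s => - 1) (fun s => 0)
      (fun s => c2 K + s) (fun s => 1) (fun s => 0)
      (kappa31 K - d) (kappa32 K)); try lra.
    1-4: intros s; auto_derive; [auto | ring].
    + intros z Hz. unfold r_gerver, X, xpiece, d.
      destruct (Rlt_dec z (2 * phi K)); [lra |].
      destruct (Rlt_dec z (2 * theta K)); [lra |].
      simpl. f_equal; ring.
    + intros z Hz. unfold t_gerver, Y, xpiece.
      destruct (Rlt_dec z (2 * phi K)); [lra |].
      destruct (Rlt_dec z (2 * theta K)); [lra |].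
      simpl. f_equal; ring.
    + intros z s r0 r1 r2 t0 t1 t2 Es H1 H2 H3 H4.
      destruct (ODE_iii_trajectory _ _ _ _ _ _ _ _ _ _ _ H1 H2 H3 H4) as [-> ->].
      rewrite <- Es. split; field.
Qed.
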